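(* Suppose that for each agent $i\in\mathcal A$: (1) $\mathcal S_i\subseteq\mathbb R^{n_i}$ is non-empty, convex and compact with diameter $D_i\ge0$; (2) $U_i$ is continuous and $U_i(s_i,s_{-i};\xi)$ is concave in $s_i$ for all $s_{-i},\xi$; (3) $U_i(s_i,s_{-i};\xi)$ is $L_i$-Lipschitz in $\xi$ for all $s_i,s_{-i}$. Then the set of Nash equilibria of the distributionally robust game is non-empty, $\mathcal{NE}(\mathcal G^{DR})\neq\emptyset$. Further, the set of Nash equilibria of the stochastic game is non-empty, $\mathcal{NE}(\mathcal G^{S})\neq\emptyset$.
   Context: Let $\mathcal A=\{1,\dots,n\}$ be a set of agents, $\mathcal S_i$ the strategy set of agent $i$, $\mathcal S=\times_{i}\mathcal S_i$, $\mathcal S_{-i}=\times_{j\ne i}\mathcal S_j$. Let $\Xi\subset\mathbb R^m$ be compact, and $\mathcal M(\Xi)$ the set of probability distributions on $\Xi$ with bounded first and second order moments. Agent $i$ obtains utility $U_i(s_i,s_{-i};\xi)$ with $\xi\in\Xi$ random, $\xi\sim\mathbb P^\star\in\mathcal M(\Xi)$, where $\mathbb P^\star$ is absolutely continuous with respect to Lebesgue measure and light-tailed (there is $a>1$ with $\mathbb E_{\xi\sim\mathbb P^\star}[\exp(\|\xi\|^a)]<\infty$). Stochastic game: $\mathcal G^S=\langle\mathcal A,\{\mathcal S_i\},\{U_i^S\}\rangle$ with $U_i^S(s_i,s_{-i})=\mathbb E_{\xi\sim\mathbb P^\star}[U_i(s_i,s_{-i};\xi)]$. Distributionally robust game: let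 $\hat\xi^{(1)},\dots,\hat\xi^{(N)}$ be i.i.d. samples of $\mathbb P^\star$, $h=[h_1^\top,\dots,h_n^\top]^\top:\mathbb R^m\to\mathbb R^m$ the stacked observation function of the agents, and $\hat{\mathbb P}_h^N=\frac1N\sum_{k=1}^N\delta_{h(\hat\xi^{(k)})}$. The Wasserstein distance is $d_W(\mathbb Q_1,\mathbb Q_2)=\inf_{\pi\in\Pi(\mathbb Q_1,\mathbb Q_2)}\int\|\xi_1-\xi_2\|_1\,\pi(d\xi_1,d\xi_2)$ ($\Pi$: couplings), and for $\mathbb P\in\mathcal M(\Xi)$, $\mathcal B_\varepsilon(\mathbb P)=\{\mathbb Q\in\mathcal M(\Xi): d_W(\mathbb Q,\mathbb P)\le\varepsilon\}$. Each agent chooses $\epsilon_i\ge0$ and has utility $U_i^{DR}(s_i,s_{-i})=\inf_{\mathbb Q\in\mathcal B_{\epsilon_i}(\hat{\mathbb P}_h^N)}\mathbb E_{\xi\sim\mathbb Q}[U_i(s_i,s_{-i};\xi)]$; $\mathcal G^{DR}=\langle\mathcal A,\{\mathcal S_i\},\{U_i^{DR}\}\rangle$. For a game with utilities $W_i$, $s^\star\in\mathcal S$ is a Nash equilibrium iff $W_i(s_i^\star,s_{-i}^\star)\ge W_i(s_i,s_{-i}^\star)$ for all $s_i\in\mathcal S_i$ and all $i\in\mathcal A$; $\mathcal{NE}(\cdot)$ denotes the set of Nash equilibria. *)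

(* Defs.v *)
From HB Require Import structures.
From mathcomp Require Import all_boot all_order all_algebra.
From mathcomp Require Import all_classical all_reals all_analysis.

Set Implicit Arguments.
Unset Strict Implicit.
Unset Printing Implicit Defensive.

Import Order.TTheory GRing.Theory Num.Theory.
Import numFieldNormedType.Exports.

Local Open Scope classical_set_scope.
Local Open Scope ring_scope.

(* The library norm on 'rV[R]_m is the sup norm, hence these two. *)
Definition norm1 (R : realType) (m : nat) (x : 'rV[R]_m) : R :=
  \sum_(i < m) `|x ord0 i|.

Definition norm2 (R : realType) (m : nat) (x : 'rV[R]_m) : R :=
  Num.sqrt (\sum_(i < m) x ord0 i ^+ 2).

Definition diameter (R : realType) (m : nat) (A : set 'rV[R]_m) : \bar R :=
  ereal_sup [set (norm2 (x - y))%:E | x in A & y in A].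

Definition concave_function (R : realType) (m : nat) (A : set 'rV[R]_m)
    (f : 'rV[R]_m -> R) : Prop :=
  @convex_function R 'rV[R]_m A (fun x => - f x).

(* R^m with its Borel sigma-algebra. *)
Notation borel R m := (g_sigma_algebraType (@open 'rV[R]_m)).

Definition box (R : realType) (m : nat) (a b : 'rV[R]_m) : set 'rV[R]_m :=
  [set x | forall i, a ord0 i <= x ord0 i <= b ord0 i].

(* Lebesgue outer measure, which is Lebesgue measure on the Borel sets.  The
   covers are indexed by subsets of nat so that finite covers are allowed also
   when m = 0, where a box has volume 1. *)
Definition lebesgue_rV (R : realType) (m : nat) (A : set (borel R m)) : \bar R :=
  ereal_inf [set v | exists (K : set nat) (a b : nat -> 'rV[R]_m),
    [/\ forall k i, a k ord0 i <= b k ord0 i,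
        A `<=` \bigcup_(k in K) box (a k) (b k) &
        v = \esum_(k in K) (\prod_(i < m) (b k ord0 i - a k ord0 i))%:E]].

Section distributions.
Context (R : realType) (m : nat).
Implicit Types (Xi : set 'rV[R]_m) (Q : probability (borel R m) R).

(* Distributions on Xi are the probabilities on R^m that are concentrated
   on Xi. *)
Definition distributions_on Xi : set (probability (borel R m) R) :=
  [set Q : probability (borel R m) R | [/\ Q Xi = 1%E,
               (\int[Q]_x (norm2 x)%:E < +oo)%E &
               (\int[Q]_x (norm2 x ^+ 2)%:E < +oo)%E]].

Definition light_tailed Q : Prop :=
  exists2 a : R, 1 < a & (\int[Q]_x (expR (norm2 x `^ a))%:E < +oo)%E.

Definition couplings (Q1 Q2 : {measure set (borel R m) -> \bar R}) :
    set (probability (borel R m * borel R m)%type R) :=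
  [set pi : probability (borel R m * borel R m)%type R | forall A : set (borel R m), measurable A ->
     pi (A `*` setT) = Q1 A /\ pi (setT `*` A) = Q2 A].

Definition wasserstein (Q1 Q2 : {measure set (borel R m) -> \bar R}) : \bar R :=
  ereal_inf [set (\int[pi]_z (norm1 (z.1 - z.2))%:E)%E | pi in couplings Q1 Q2].

Definition wasserstein_ball Xi (eps : R)
    (P : {measure set (borel R m) -> \bar R}) :
    set (probability (borel R m) R) :=
  [set Q : probability (borel R m) R | distributions_on Xi Q /\ (wasserstein Q P <= eps%:E)%E].

(* N^-1 * \sum_(k < N) \d_(x k); msum takes families indexed by nat, hence
   the insub. *)
Definition empirical (N : nat) (x : 'I_N -> 'rV[R]_m) :
    {measure set (borel R m) -> \bar R} :=
  mscale ((N%:R : R)^-1)%:nng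
    (msum (fun k : nat =>
       if insub k is Some j then dirac (x j : borel R m) else mzero) N).

(* Every integrand is used only on Xi, where Q is concentrated. *)
Definition expectation_on Xi Q (f : 'rV[R]_m -> R) : \bar R :=
  (\int[Q]_(x in Xi) (f x)%:E)%E.

End distributions.

Definition iid (R : realType) (m N : nat) (d : measure_display)
    (Omega : measurableType d) (Pr : probability Omega R)
    (P : probability (borel R m) R) (X : 'I_N -> {RV Pr >-> borel R m}) : Prop :=
  (forall k (A : set (borel R m)), measurable A ->
     distribution Pr (X k) A = P A) /\
  (forall (J : {set 'I_N}) (B : 'I_N -> set (borel R m)),
     (forall k, measurable (B k)) ->
     Pr (\bigcap_(k in [set k | k \in J]) X k @^-1` B k) =
       (\prod_(k in J) Pr (X k @^-1` B k))%E).

(* Strategy profiles, with the product topology. *)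
Notation profile R d := (prod_topology (fun i => 'rV[R]_(d i))).

Section games.
Context (R : realType) (n : nat) (d : 'I_n -> nat).
Local Notation profile := (profile R d).

(* (x, s_{-i}) *)
Definition deviate (s : profile) (i : 'I_n) (x : 'rV[R]_(d i)) : profile :=
  @dfwith _ (fun j => 'rV[R]_(d j)) s i x.

(* Utilities are extended real because an infimum of expectations is. *)
Record game := Game {
  strategy : forall i : 'I_n, set 'rV[R]_(d i);
  utility : 'I_n -> profile -> \bar R }.

Arguments strategy : clear implicits.

Definition nash_equilibria (G : game) : set profile :=
  [set s | (forall i, strategy G i (s i)) /\
     forall i x, strategy G i x ->
       (utility G i (deviate s x) <= utility G i s)%E].

Context (m : nat) (S : forall i : 'I_n, set 'rV[R]_(d i)) (Xi : set 'rV[R]_m)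
  (U : 'I_n -> profile -> 'rV[R]_m -> R).

Definition stochastic_game (P : probability (borel R m) R) : game :=
  Game S (fun i s => expectation_on Xi P (U i s)).

(* The centre Phat of the balls need not be concentrated on Xi.  If a ball is
   empty then the infimum is +oo. *)
Definition robust_game (eps : 'I_n -> R)
    (Phat : {measure set (borel R m) -> \bar R}) : game :=
  Game S (fun i s => ereal_inf
    [set expectation_on Xi Q (U i s) | Q in wasserstein_ball Xi (eps i) Phat]).

End games.

(* Main.v *)
Require Import Defs.
From HB Require Import structures.
From mathcomp Require Import all_boot all_order all_algebra.
From mathcomp Require Import zify.

(** Both games are instances of one kind of game: agent [i] has a set of
    probabilities on the compact [Xi] and maximizes the worst expectation of its
    utility over that set.  The set is a Wasserstein ball in the robust game and
    a singleton in the stochastic one.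

    If the set of an agent is empty, then its utility is [+oo] at every profile
    and it never wants to deviate.  Otherwise its utility is a real function
    which is concave in its own strategy, as expectations and infima preserve
    concavity, and continuous on the feasible profiles: since [Xi] is compact, a
    small change of the profile changes the utility little, uniformly in the
    uncertain parameter, and therefore changes all expectations and their
    infimum little (lemmas [worst_mean_concave] and [worst_mean_continuous]).

    It remains to show that a continuous game with compact convex strategy sets
    has an equilibrium if utilities are concave in the own strategy
    ([concave_game_nash]).  Let the gain of [y] over [s] be the sum over the
    agents of what each would gain by switching alone from its part of [s] to
    its part of [y].  A profile over which no [y] has a positive gain is an
    equilibrium, and by compactness only finitely many [y] have to be handled at
    a time.  For those, look for a mixture [s] of the [y j] such that every
    [y j] with positive weight has maximal gain over [s]; by concavity the
    weighted average of these gains is at most the gain of [s] over itself,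
    which is 0.

    Such a mixture is given by [simplex_cover], a form of Brouwer's fixed point
    theorem for closed covers of a simplex.  It follows in the limit of fine
    grids from Scarf's lemma ([scarf_lemma]), a purely combinatorial statement
    about a finite set with several linear orders, which the parity argument of
    Sperner's lemma proves without any triangulation. *)

Set Implicit Arguments.
Unset Strict Implicit.
Unset Printing Implicit Defensive.

(** * Scarf's lemma *)

Section scarf.
Variables (I W : finType) (rk : I -> W -> nat).
Hypothesis rk_inj : forall l, injective (rk l).

Definition least (X : {set W}) (l : I) (w : W) :=
  [forall x in X, rk l w <= rk l x].

(** No element of [W] exceeds the minimum of [X] in every order at once.  Such
    sets play the role of the simplices of a triangulation. *)
Definition dominant (X : {set W}) := [forall w, [exists l, least X l w]].

Lemma leastP (X : {set W}) l w :
  reflect (forall x, x \in X -> rk l w <= rk l x) (least X l w).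
Proof. exact: forall_inP. Qed.

Lemma dominantP (X : {set W}) :
  reflect (forall w, exists l, least X l w) (dominant X).
Proof. by apply: (iffP forallP) => H w; apply/existsP. Qed.

Lemma dominantS (X Y : {set W}) : Y \subset X -> dominant X -> dominant Y.
Proof.
move=> /subsetP YX /dominantP dX; apply/dominantP => w.
have [l /leastP lw] := dX w; exists l; apply/leastP => x /YX; exact: lw.
Qed.

Lemma least_uniq (X : {set W}) l x y : x \in X -> y \in X ->
  least X l x -> least X l y -> x = y.
Proof.
move=> xX yX /leastP lx /leastP ly; apply: (@rk_inj l); apply/eqP.
by rewrite eqn_leq lx// ly.
Qed.

(** Each element of a dominant set is the least one in some order, and
    distinct elements use distinct orders; the orders in [B] are used by no
    element of [A]. *)
Lemma card_dominant (X A : {set W}) (B : {set I}) : dominant X ->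
  A \subset X -> (forall l w, l \in B -> w \in A -> ~~ least X l w) ->
  #|A| + #|B| <= #|I|.
Proof.
move=> /dominantP dX /subsetP AX BA.
pose j w := xchoose (dX w).
have lj w : least X (j w) w by exact: (xchooseP (dX w)).
have j_inj : {in A &, injective j}.
  move=> x y xA yA e; apply: (@least_uniq X (j x)); rewrite ?AX// e//.
rewrite -(card_in_imset j_inj) -(leq_add2r #|~: B|) -addnA cardsC addnC.
rewrite leq_add2l subset_leq_card//; apply/subsetP => _ /imsetP[w wA ->].
by rewrite inE; apply/negP => jB; have := BA _ _ jB wA; rewrite lj.
Qed.

Lemma least_setU1 (Y : {set W}) l w y : w \notin Y -> y \in Y ->
  least (w |: Y) l w -> ~~ least (w |: Y) l y.
Proof.
move=> wY yY lw; apply: contra wY => ly.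
by rewrite (least_uniq _ _ lw ly) ?inE ?eqxx ?yY ?orbT.
Qed.

(** The elements that can be added to [Y] without taking over the minimum in
    an order other than [x]. *)
Definition entering (Y : {set W}) (x : I) :=
  [set w | [forall l, (l != x) ==> ~~ least Y l w]].

Definition completions (Y : {set W}) :=
  [set w | (w \notin Y) && dominant (w |: Y)].

(** A completion that is least for [x] is entering: were it least for a second
    order too, too few orders would remain for the elements of [Y] to be least
    in.  It is the maximum, in order [x], of the entering elements: if another
    one were added, that maximum would exceed the minimum in every order. *)
Lemma card_completions_least (Y : {set W}) (x : I) : dominant Y ->
  #|Y|.+1 = #|I| ->
  (forall y, y \in Y -> exists2 l, l != x & least Y l y) ->
  entering Y x != set0 ->
  #|[set w in completions Y | least (w |: Y) x w]| = 1.
Proof.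
move=> dY cY leY /set0Pn[w0 w0E].
have leE w : w \in entering Y x -> least Y x w.
  rewrite inE => /forallP wE; have [l lw] := dominantP _ dY w.
  by case: (eqVneq l x) lw => [->//|lx]; have := wE l; rewrite lx/= => /negPf->.
have EY w : w \in entering Y x -> w \notin Y.
  rewrite inE => /forallP wE; apply/negP => /leY[l lx]; apply/negP.
  by have := wE l; rewrite lx.
have [v vE0 vmax] := arg_maxnP (rk x) w0E.
have vE : v \in entering Y x := vE0.
have {}vmax z : z \in entering Y x -> rk x z <= rk x v := vmax z.
apply/eqP/cards1P; exists v; apply/setP => w; rewrite !inE -andbA.
apply/and3P/eqP => [[wY dw lw]|->].
  have wE : w \in entering Y x.
    rewrite inE; apply/forallP => l; apply/implyP => lx.
    apply/negP => /leastP lew.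
    suff : #|Y| + #|[set x; l]| <= #|I| by rewrite cards2 eq_sym lx -cY; lia.
    apply: (card_dominant dw); first exact: subsetUr.
    have wl : least (w |: Y) l w.
      by apply/leastP => z; rewrite !inE => /predU1P[->//|/lew].
    by move=> k y; rewrite !inE => /orP[]/eqP-> yY; exact: least_setU1.
  have [l /leastP lv] := dominantP _ dw v.
  have := vE; rewrite inE => /forallP/(_ l).
  have [lx _|lx /=] := eqVneq l x; last first.
    by case/negP; apply/leastP => y yY; apply: lv; rewrite !inE yY orbT.
  apply: (@rk_inj x); apply/eqP; rewrite eqn_leq vmax// -lx lv//.
  by rewrite !inE eqxx.
have vY := EY _ vE; have /leastP lev := leE _ vE.
split=> //; last by apply/leastP => z; rewrite !inE => /predU1P[->//|/lev].
apply/dominantP => u.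
have [uE|] := boolP (u \in entering Y x).
  exists x; apply/leastP => z; rewrite !inE => /predU1P[->|zY].
    exact: vmax.
  exact: leq_trans (vmax _ uE) (lev _ zY).
rewrite inE negb_forall => /existsP[l].
rewrite negb_imply negbK => /andP[lx lew].
exists l; apply/leastP => z; rewrite !inE => /predU1P[->|]; last first.
  exact: (leastP _ _ _ lew).
move: vE; rewrite inE => /forallP/(_ l).
rewrite lx/= negb_forall => /existsP[y].
rewrite negb_imply -ltnNge => /andP[yY /ltnW]; apply: leq_trans.
exact: (leastP _ _ _ lew).
Qed.

(** [Y] has one element fewer than there are orders, so exactly one element of
    [Y] is the least one for two orders [a] and [b], and the others for one.  A
    new element has to take over the order [a] or the order [b], never both,
    and [card_completions_least] gives one new element in each case.  This is
    the analogue of an interior facet lying in exactly two simplices. *)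
Lemma card_completions (Y : {set W}) : Y != set0 -> dominant Y ->
  #|Y|.+1 = #|I| -> (forall x, entering Y x != set0) ->
  #|completions Y| = 2.
Proof.
move=> /set0Pn[y0 y0Y] dY cY E0.
pose mn l := [arg min_(w < y0 | w \in Y) rk l w].
have mnY l : mn l \in Y by rewrite /mn; case: arg_minnP.
have mnL l : least Y l (mn l).
  by apply/leastP => y yY; rewrite /mn; case: arg_minnP => // i _; apply.
have mnE l y : y \in Y -> least Y l y -> y = mn l.
  by move=> yY ly; apply: least_uniq ly _.
have : ~~ injectiveb mn.
  apply/injectiveP => mn_inj; have cmn := card_imset predT mn_inj.
  suff : #|I| <= #|Y| by rewrite -cY ltnn.
  by rewrite -cmn subset_leq_card//; apply/subsetP => _ /imsetP[l _ ->].
case/injectivePn => a [b ab mab].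
have leY x : x \in [set a; b] -> forall y, y \in Y ->
    exists2 l, l != x & least Y l y.
  move=> xab y yY; have [l ly] := dominantP _ dY y.
  have [lx|] := eqVneq l x; last by exists l.
  move: xab; rewrite !inE => /orP[]/eqP xE; [exists b|exists a];
    rewrite ?xE// 1?eq_sym//; rewrite -lx in xE; rewrite xE in ly;
    by rewrite (mnE _ _ yY ly) ?mab// -mab.
have completionsE :
    completions Y = [set w in completions Y | least (w |: Y) a w] :|:
                    [set w in completions Y | least (w |: Y) b w].
  apply/setP => w; rewrite !inE -andb_orr; case: (boolP (w \in Y)) => //= wY.
  case: (boolP (dominant _)) => //= dw; apply/esym/negbNE; rewrite negb_or.
  apply/negP => /andP[law lbw].
  have [l lw] := dominantP _ dw w.
  have la : l != a by apply: contraNneq law => <-.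
  have lb : l != b by apply: contraNneq lbw => <-.
  have : #|Y :\ mn a| + #|l |: [set a; b]| <= #|I|.
    apply: (card_dominant dw).
      exact: subset_trans (subsetDl _ _) (subsetUr _ _).
    move=> k y; rewrite !inE => kab /andP[ymn yY]; apply/negP => ky.
    have kYy : least Y k y.
      by apply/leastP => z zY; apply: (leastP _ _ _ ky); rewrite !inE zY orbT.
    case/or3P: kab => /eqP kE; rewrite kE in ky kYy.
    - by move/negP: (least_setU1 wY yY lw); apply.
    - by rewrite (mnE _ _ yY kYy) eqxx in ymn.
    - by rewrite (mnE _ _ yY kYy) mab eqxx in ymn.
  have := cardsD1 (mn a) Y; rewrite mnY => cYm.
  by rewrite cardsU1 cards2 !inE negb_or la lb ab -cY cYm; lia.
rewrite completionsE cardsU !card_completions_least//;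
  try by apply: leY; rewrite !inE eqxx ?orbT.
suff -> : [set w in completions Y | least (w |: Y) a w] :&:
          [set w in completions Y | least (w |: Y) b w] = set0.
  by rewrite cards0.
apply/setP => w; rewrite !inE.
apply/negP => /andP[/andP[/andP[wY dw] aw] /andP[_ bw]].
suff : #|Y| + #|[set a; b]| <= #|I| by rewrite cards2 ab -cY; lia.
apply: (card_dominant dw); first exact: subsetUr.
by move=> k y; rewrite !inE => /orP[]/eqP-> yY; exact: least_setU1.
Qed.

(** The slack element of [l] lies below everything in the order [l], and above
    all non-slack elements in the other orders.  Slack elements stand for the
    faces of the boundary: the door made of all slack elements but that of
    [i0] is the only door for [i0] on the boundary. *)
Variables (slack : I -> W) (c : W -> I).
Hypothesis slackK : cancel slack c.
Hypothesis slack_min : forall l w, rk l (slack l) <= rk l w.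
Hypothesis slack_max : forall l k w, l != k -> w \notin codom slack ->
  rk l w < rk l (slack k).

(** Rooms are the full-dimensional cells; the doors for [i0] are the facets
    which carry all labels except [i0]. *)
Definition rooms := [set X | dominant X && (#|X| == #|I|)].

Definition doors i0 :=
  [set Y | [&& dominant Y, #|Y|.+1 == #|I| & c @: Y == [set~ i0]]].

(** Both sides count the pairs of a door and a room containing it. *)
Lemma card_doors_rooms i0 :
  \sum_(Y in doors i0) #|completions Y| =
  \sum_(X in rooms) #|[set w in X | X :\ w \in doors i0]|.
Proof.
under eq_bigr do rewrite -sum1_card big_mkcond.
under [RHS]eq_bigr do rewrite -sum1_card big_mkcond.
rewrite exchange_big [RHS]exchange_big /=; apply: eq_bigr => w _.
rewrite -!big_mkcondr.
rewrite [RHS](reindex_onto (fun Y => w |: Y) (fun X => X :\ w)) /=; last first.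
  by move=> X /andP[_]; rewrite inE => /andP[wX _]; rewrite setD1K.
apply: eq_bigl => Y; rewrite ![in RHS]inE eqxx /=.
have [wY|wY] := boolP (w \in Y).
  rewrite [w \in completions Y]in_set wY /= andbF; apply/esym/negbTE.
  rewrite negb_and.
  by apply/orP; right; apply: contraTneq wY => <-; rewrite !inE eqxx.
rewrite setU1K// eqxx andbT [w \in completions Y]in_set wY /= cardsU1 wY add1n.
rewrite !inE [LHS]andbC; case: (dominant _) => //=.
by case: (_ == #|I|) => //=; rewrite andbF.
Qed.

(** If some door is obtained by removing [y0], then the label of [y0] occurs
    exactly once more, at some [y1], and [y0], [y1] are the only elements whose
    removal gives a door. *)
Lemma even_card_doors i0 X : X \in rooms -> c @: X != setT ->
  ~~ odd #|[set w in X | X :\ w \in doors i0]|.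
Proof.
move=> rX nX; set D := [set w in X | _].
have [->|/set0Pn[y0]] := eqVneq D set0; first by rewrite cards0.
rewrite !inE => /andP[y0X /and3P[_ cX /eqP iX]].
have cy0 : c y0 != i0.
  apply: contraNneq nX => cy0; rewrite -(setD1K y0X) imsetU1 iX cy0.
  by apply/eqP/setP => l; rewrite !inE; case: eqP.
have : c y0 \in c @: (X :\ y0) by rewrite iX !inE.
case/imsetP => y1; rewrite !inE => /andP[y10 y1X] cy01.
have c_inj : {in X :\ y0 &, injective c}.
  apply/imset_injP; rewrite iX cardsC1 -(eqP cX) //.
suff -> : D = [set y0; y1] by rewrite cards2 eq_sym y10.
have imX w : w \in X -> c @: X = c w |: c @: (X :\ w).
  by move=> wX; rewrite -imsetU1 setD1K.
have cD : c @: X = [set~ i0].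
  by rewrite (imX _ y0X) iX; apply/setP => l; rewrite !inE; case: eqP => // ->.
have rw w : w \in X -> #|X :\ w|.+1 = #|I|.
  by move: rX; rewrite inE => /andP[_ /eqP<-] wX; rewrite (cardsD1 w X) wX.
apply/setP => w; rewrite !inE.
apply/idP/idP => [/andP[wX /and3P[_ _ /eqP iw]]|].
  apply/negPn/negP; rewrite negb_or => /andP[wy0 wy1].
  have : c w \in c @: (X :\ w) by rewrite iw -cD imset_f.
  case/imsetP => z; rewrite !inE => /andP[zw zX] cwz.
  have [zy0|zy0] := eqVneq z y0.
    move/eqP: wy1; apply; apply: c_inj; rewrite ?inE ?wy0 ?y10//.
    by rewrite cwz zy0.
  move/eqP: zw; apply; apply: c_inj; rewrite ?inE ?zy0 ?wy0//.
move: rX; rewrite inE => /andP[dX _].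
case/orP => /eqP ->; rewrite ?y0X ?y1X /= (dominantS _ dX) ?subsetDl//=;
  rewrite rw//= ?eqxx ?iX ?eqxx//=.
rewrite -cD; apply/eqP/setP => l; apply/imsetP/imsetP => -[z].
  by rewrite !inE => /andP[_ zX] ->; exists z.
move=> zX ->; have [->|zy1] := eqVneq z y1; last first.
  by exists z; rewrite // !inE zy1.
(* y0 replaces y1, as both carry the same label *)
by exists y0 => //; rewrite !inE eq_sym y10.
Qed.

(** The parity argument of Sperner's lemma.  The door made of all slack
    elements but that of [i0] lies in one room and every other door in two, so
    the number of incidences is odd and some room has an odd number of doors;
    by [even_card_doors] that room carries every label. *)
Lemma exists_rainbow_room (i0 : I) (w0 : W) : w0 \notin codom slack ->
  exists2 X, dominant X & c @: X = setT.
Proof.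
move=> w0s; pose Y0 := slack @: [set~ i0].
have slack_inj : injective slack := can_inj slackK.
have cY0 : #|Y0|.+1 = #|I|.
  rewrite card_imset// cardsC1 prednK//; apply/card_gt0P; by exists i0.
have leY0 l : l != i0 -> least Y0 l (slack l).
  by move=> li0; apply/leastP.
have dY0 : dominant Y0.
  apply/dominantP => w; have [/codomP[l ->]|ws] := boolP (w \in codom slack).
    by exists l; apply/leastP.
  exists i0; apply/leastP => _ /imsetP[k ki0 ->]; rewrite !inE in ki0.
  by rewrite ltnW// slack_max// eq_sym.
have Y0D : Y0 \in doors i0.
  rewrite inE dY0 cY0 eqxx /= -imset_comp; apply/eqP/setP => l.
  apply/imsetP/idP => [[k ki0 ->]|li0]; first by rewrite /= slackK.
  by exists l => //=; rewrite slackK.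
have odd0 : #|completions Y0| = 1.
  rewrite -(@card_completions_least Y0 i0)//; last 2 first.
  - by move=> _ /imsetP[l li0 ->]; rewrite !inE in li0; exists l; rewrite ?leY0.
  - apply/set0Pn; exists w0; rewrite inE.
    apply/forallP => l; apply/implyP => li0.
    apply/negP => /leastP/(_ (slack l)).
    rewrite imset_f ?inE// => /(_ isT) lw.
    move/negP: w0s; apply; rewrite (_ : w0 = slack l) ?codom_f//.
    by apply: (@rk_inj l); apply/eqP; rewrite eqn_leq lw slack_min.
  congr #|pred_of_set _|; apply/setP => w; rewrite !inE.
  case: (boolP (w \in Y0)) => //= wY0; case: (boolP (dominant _)) => //= dw.
  apply/esym/leastP => z; rewrite in_setU1 => /predU1P[->//|/imsetP[l li0 ->]].
  rewrite !inE in li0; have [/codomP[k wk]|ws] := boolP (w \in codom slack).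
    suff -> : w = slack i0 by [].
    have [<-//|ki0] := eqVneq k i0.
    by move: wY0; rewrite wk imset_f// !inE.
  by rewrite ltnW// slack_max// eq_sym.
have even_other Y : Y \in doors i0 -> Y != Y0 -> ~~ odd #|completions Y|.
  rewrite inE => /and3P[dY /eqP cY /eqP iY] YY0.
  have YE : [exists y in Y, y \notin codom slack].
    apply: contraNT YY0; rewrite negb_exists => /forallP nY.
    rewrite eqEcard -(leq_add2l 1) !add1n cY cY0 leqnn andbT.
    apply/subsetP => y yY; have := nY y; rewrite yY /= negbK => /codomP[l yl].
    by rewrite yl imset_f// -iY -(slackK l) -yl imset_f.
  case/exists_inP: YE => y0 y0Y y0s.
  rewrite card_completions//; first by apply/set0Pn; exists y0.
  move=> x; apply/set0Pn; exists (slack x); rewrite inE.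
  apply/forallP => l; apply/implyP => lx; apply/negP => /leastP/(_ _ y0Y).
  by rewrite leqNgt slack_max.
have even_sum (J : finType) (P : pred J) (F : J -> nat) :
    (forall j, P j -> ~~ odd (F j)) -> ~~ odd (\sum_(j | P j) F j).
  move=> PF; apply: (big_ind (fun k => ~~ odd k)) => // p q; rewrite oddD.
  by move=> /negPf-> /negPf->.
have [/exists_inP[X]|] := boolP [exists X in rooms, c @: X == setT].
  by rewrite inE => /andP[dX _] /eqP cX; exists X.
rewrite negb_exists => /forallP noX.
have : ~~ odd (\sum_(Y in doors i0) #|completions Y|).
  rewrite card_doors_rooms; apply: even_sum => X rX.
  by apply: even_card_doors => //; have := noX X; rewrite rX.
rewrite (bigD1 Y0)//= odd0 oddD /= negbK => /negPn/negP[].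
by apply: even_sum => Y /andP[]; exact: even_other.
Qed.

End scarf.

Section scarf_lemma.
Variables (I V : finType) (f : I -> V -> nat) (c : V -> I).
Hypothesis f_inj : forall l, injective (f l).

(** The original elements keep their order, shifted by one to leave room for
    the slack element of [l] at the bottom; the other slack elements come on
    top, in an arbitrary order. *)
Let rk (l : I) (w : V + I) : nat :=
  match w with
  | inl v => (f l v).+1
  | inr k => if k == l then 0 else (\max_v (f l v)).+2 + enum_rank k
  end.

Let rk_inj l : injective (rk l).
Proof.
have bnd v : f l v <= \max_v (f l v) by exact: leq_bigmax.
move=> [v|k] [v'|k'] //=.
- by case=> /f_inj ->.
- by case: eqP => // _ e; have := bnd v; lia.
- by case: eqP => // _ e; have := bnd v'; lia.
- case: eqP => [->|_]; case: eqP => [->|_] // e.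
  by congr inr; apply/enum_rank_inj/val_inj => /=; lia.
Qed.

(** Scarf's lemma: the elements of a rainbow room that are not slack carry
    exactly the labels whose slack elements are absent, and dominance against
    an original element can only be witnessed by such a label. *)
Lemma scarf_lemma (v0 : V) : exists S : {set V},
  forall v, exists2 l, l \in c @: S & forall s, s \in S -> f l v <= f l s.
Proof.
pose c' (w : V + I) := match w with inl v => c v | inr k => k end.
have [||||X dX cX] :=
  @exists_rainbow_room _ _ _ rk_inj inr c' _ _ _ (c v0) (inl v0).
- by [].
- by move=> l w /=; rewrite eqxx.
- move=> l k [v|j] /= lk.
    by rewrite eq_sym (negPf lk) => _; have := leq_bigmax (F := f l) v; lia.
  by rewrite codom_f.
- by apply/codomP => -[].
exists [set v | inl v \in X] => v.
have [l /leastP lv] := dominantP _ _ dX (inl v).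
exists l; last by move=> s; rewrite inE => /lv.
have : l \in c' @: X by rewrite cX.
case/imsetP => -[s sX ->|k kX lk]; first by rewrite /= imset_f// inE.
by have := lv _ kX; rewrite /= -[k]/(c' (inr k)) -lk eqxx.
Qed.

End scarf_lemma.

(** * Dominant sets of grid points *)

Section grid.
Variables (p K : nat).

Definition grid := {v : {ffun 'I_p.+1 -> 'I_K.+1} | \sum_j v j == K :> nat}.

Lemma grid_of (g : 'I_p.+1 -> nat) : \sum_j g j = K ->
  exists v : grid, forall j, val v j = g j :> nat.
Proof.
move=> gK; pose v := [ffun j => inord (g j) : 'I_K.+1].
have vg j : v j = g j :> nat.
  by rewrite ffunE inordK// ltnS -gK (bigD1 j)//= leq_addr.
have vK : \sum_j v j == K :> nat by rewrite (eq_bigr g)// gK.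
by exists (exist _ v vK).
Qed.

(** Scarf's lemma for the orders by coordinate.  The sum of the coordinatewise
    minima [m] of the set it provides is within [p.+1] of [K]: otherwise a grid
    point could exceed all these minima.  As the coordinates of a grid point
    sum to [K], all points of the set agree with [m], and so with each other, up
    to [p] in each coordinate. *)
Lemma grid_cluster (c : grid -> 'I_p.+1) : exists s0 : grid, forall l,
  (val s0 l <= p)%N \/ exists2 s : grid, c s = l &
     forall j, (val s j <= val s0 j + p)%N /\ (val s0 j <= val s j + p)%N.
Proof.
(* ties between equal coordinates are broken by an enumeration of the grid *)
pose f (l : 'I_p.+1) (v : grid) := (val v l * #|{: grid}| + enum_rank v)%N.
have fP l v w : f l v <= f l w -> val v l <= val w l.
  rewrite /f; apply: contraLR; rewrite -!ltnNge => wv.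
  apply: leq_trans (leq_addr _ _); apply: leq_trans (leq_mul wv (leqnn _)).
  by rewrite mulSn addnC ltn_add2r ltn_ord.
have f_inj l : injective (f l).
  move=> v w e; apply/enum_rank_inj/val_inj.
  have vw : val v l = val w l :> nat.
    by apply/eqP; rewrite eqn_leq !fP ?e.
  by move/eqP: e; rewrite /f vw eqn_add2l => /eqP.
have sum_ord0 x : \sum_(j < p.+1) (j == ord0) * x = x.
  by rewrite big_ord_recl eqxx mul1n big1 ?addn0.
have [v0 _] : exists v : grid, forall j, val v j = (j == ord0) * K :> nat.
  by apply: grid_of; exact: sum_ord0.
have [S dS] := scarf_lemma c f_inj v0.
have [l0 /imsetP[s0 s0S _] _] := dS v0.
(* if no point of S has label l, then 0 serves as the minimum *)
pose m l :=
  if l \in c @: S then val [arg min_(s < s0 | s \in S) f l s] l : nat else 0.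
have m_le l s : s \in S -> m l <= val s l.
  rewrite /m => sS; case: ifP => // _; case: arg_minnP => // t tS tmin.
  by apply/fP/tmin.
have sum_m : K < \sum_l m l + p.+1.
  rewrite ltnNge; apply/negP => le_mK.
  have [v vE] : exists v : grid, forall j, val v j =
      ((m j).+1 + (j == ord0) * (K - (\sum_l m l + p.+1)))%N :> nat.
    apply: grid_of; rewrite big_split/=.
    rewrite [X in (_ + X)%N](_ : _ = (K - (\sum_l m l + p.+1))%N).
      under eq_bigr do rewrite -addn1.
      by rewrite big_split/= sum1_card card_ord subnKC.
    exact: sum_ord0.
  have [l lC lv] := dS v.
  have : val v l <= m l.
    by rewrite /m lC; case: arg_minnP => // t tS _; apply/fP/lv.
  by rewrite vE; lia.
have le_m l s : s \in S -> val s l <= m l + p.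
  move=> sS; have sK := eqP (valP s).
  have : \sum_(j | j != l) m j <= \sum_(j | j != l) val s j.
    by apply: leq_sum => j _; exact: m_le.
  move: sK; rewrite (bigD1 l)//=; have := sum_m; rewrite (bigD1 l)//=.
  move: (\sum_(i | i != l) m i) (\sum_(i | i != l) val s i) => a b; lia.
exists s0 => l; have [|lC] := boolP (l \in c @: S).
  case/imsetP => s sS ->; right; exists s => // j.
  have := m_le j _ sS; have := m_le j _ s0S; have := le_m j _ sS.
  have := le_m j _ s0S.
  move: (m j) (nat_of_ord (val s j)) (nat_of_ord (val s0 j)) => a b b'; lia.
by left; have := le_m l _ s0S; rewrite /m (negPf lC).
Qed.
End grid.

(** * Closed covers of the simplex *)

From mathcomp Require Import finmap.
From mathcomp Require Import all_classical all_reals all_analysis.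
From mathcomp Require Import lra.
Import Order.TTheory GRing.Theory Num.Theory.
Import numFieldNormedType.Exports.
Local Open Scope classical_set_scope.
Local Open Scope ring_scope.

Section simplex.
Variables (R : realType).

Definition simplex k : set 'rV[R]_k :=
  [set t | (forall j, 0 <= t ord0 j) /\ \sum_j t ord0 j = 1].

Lemma compact_simplex k : compact (@simplex k).
Proof.
apply: (@subclosed_compact _ _
  [set t : 'rV[R]_k | forall j, `[0, 1]%classic (t ord0 j)]).
- rewrite (_ : @simplex k = \bigcap_j [set t : 'rV[R]_k | 0 <= t ord0 j] `&`
    [set t : 'rV[R]_k | \sum_j t ord0 j = 1]); last first.
    apply/seteqP; split => t /= [h1 h2]; split => // j; [move=> _|].
      exact: h1.
    exact: h1.
  apply: closedI.
    apply: closed_bigI => j _.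
    apply: (@closed_comp _ _ (fun t : 'rV[R]_k => t ord0 j)
      [set x : R | 0 <= x]).
      by move=> t _; exact: coord_continuous.
    exact: closed_ge.
  apply: (@closed_comp _ _ (fun t : 'rV[R]_k => \sum_j t ord0 j)
    [set x : R | x = 1]).
    move=> t _; apply: (@continuous_big _ _ +%R 0) => [|j _].
      exact: add_continuous.
    exact: coord_continuous.
  exact: closed_eq.
- apply: (@rV_compact R k (fun=> `[0, 1]%classic)) => j.
  exact: segment_compact.
- move=> t [t0 t1] j /=; rewrite in_itv/= t0 -t1 (bigD1 j)//= lerDl.
  by apply: sumr_ge0 => i _; exact: t0.
Qed.

(** Label each point of the grid of mesh [1 / K] by a set of the cover that
    contains it, and apply [grid_cluster]. *)
Lemma simplex_cover_approx p (A : 'I_p.+1 -> set 'rV[R]_p.+1) (K : nat) :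
  (forall t, simplex t -> exists l, A l t) -> (0 < K)%N ->
  exists2 t, simplex t & forall l, t ord0 l <= p.+1%:R / K%:R \/
     exists2 y, A l y & ball t (p.+1%:R / K%:R) y.
Proof.
move=> cov K0; have KR : 0 < K%:R :> R by rewrite ltr0n.
pose pt (v : grid p K) : 'rV[R]_p.+1 := \row_j ((val v j : nat)%:R / K%:R).
have ptE v j : pt v ord0 j = (val v j : nat)%:R / K%:R by rewrite mxE.
have pt_simplex v : simplex (pt v).
  split; first by move=> j; rewrite ptE divr_ge0.
  under eq_bigr do rewrite ptE.
  by rewrite -mulr_suml -natr_sum (eqP (valP v)) divff// gt_eqF.
have [c cP] := choice (fun v => cov _ (pt_simplex v)).
have [s0 s0P] := grid_cluster c.
exists (pt s0) => // l; case: (s0P l) => [s0l|[s <- s0s]]; [left|right].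
  by rewrite ptE ler_pM2r ?invr_gt0// ler_nat ltnW.
exists (pt s); first exact: cP.
split; first by rewrite divr_gt0.
move=> i j; rewrite (ord1 i) /ball/= !ptE -mulrBl normrM.
rewrite (gtr0_norm (x := K%:R^-1)) ?invr_gt0//.
rewrite ltr_pM2r ?invr_gt0// ltr_norml.
apply/andP; split.
  by rewrite ltrBrDl ltrBlDr -natrD ltr_nat addnS ltnS; case: (s0s j).
by rewrite ltrBlDl -natrD ltr_nat addnS ltnS; case: (s0s j).
Qed.

(** Equivalent to Brouwer's fixed point theorem: whenever closed sets indexed
    by the vertices cover the simplex, some point lies in every set whose
    vertex has positive weight at that point.  It is the limit of
    [simplex_cover_approx]: if every point failed for some [l], then
    it would fail with a uniform margin, by compactness. *)
Lemma simplex_cover p (A : 'I_p.+1 -> set 'rV[R]_p.+1) :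
  (forall l, closed (A l)) -> (forall t, simplex t -> exists l, A l t) ->
  exists2 t, simplex t & forall l, 0 < t ord0 l -> A l t.
Proof.
move=> clA cov; apply: contrapT => noT.
have bad t : simplex t -> exists2 l, 0 < t ord0 l & ~ A l t.
  move=> st; apply: contrapT => h; apply: noT; exists t => // l tl.
  by apply: contrapT => nA; apply: h; exists l.
pose e (K : nat) : R := p.+1%:R / K.+1%:R.
have e_cvg0 : e @ \oo --> 0.
  rewrite -(mulr0 (p.+1%:R : R)); apply: cvgM; first exact: cvg_cst.
  exact: cvg_harmonic.
have : \forall K \near \oo, @simplex p.+1 `<=` (fun t => ~ forall l,
    t ord0 l <= e K \/ exists2 y, A l y & ball t (e K) y).
  have /compact_near_coveringP := @compact_simplex p.+1.
  apply=> t /bad[l tl nA].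
  have : nbhs t (~` A l).
    by apply: open_nbhs_nbhs; split; [exact: closed_openC|].
  rewrite nbhs_ballP => -[r /= r0 rA].
  have tl2 : 0 < t ord0 l / 2 by rewrite divr_gt0.
  have r2 : 0 < r / 2 by rewrite divr_gt0.
  near=> x K => /= h; case: (h l) => [|[y Ay xy]].
    apply/negP; rewrite -ltNge; apply: (@lt_trans _ _ (t ord0 l / 2)).
      by near: K; exact: (cvgr_lt 0 e_cvg0).
    near: x; apply: (cvgr_gt (t ord0 l)); first exact: coord_continuous.
    by rewrite ltr_pdivrMr// mulr2n mulrDr mulr1 ltrDl.
  apply: (rA y) => //; rewrite [r]splitr; apply: (@ball_triangle _ _ x).
    by near: x; exact: nbhsx_ballx.
  apply: le_ball xy; apply: ltW; near: K; exact: (cvgr_lt 0 e_cvg0).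
case=> K0 _ /(_ K0); rewrite /= leqnn => /(_ isT) h.
have [t st] := @simplex_cover_approx _ A K0.+1 cov isT.
exact: h.
Unshelve. all: by end_near. Qed.
End simplex.

(** * Jensen's inequality *)

Section convex.
Variables (R : realType) (d : nat) (A : set 'rV[R]_d).

Lemma convex_setP : convex_set A -> forall x y (l : R), A x -> A y ->
  0 <= l -> l <= 1 -> A (l *: x + (1 - l) *: y).
Proof.
move=> cA x y l Ax Ay l0 l1; apply: set_mem.
by apply: (cA x y (Itv01 l0 l1)); apply: mem_set.
Qed.

Lemma concave_functionP (f : 'rV[R]_d -> R) : concave_function A f ->
  forall x y (l : R), A x -> A y -> 0 <= l -> l <= 1 ->
  l * f x + (1 - l) * f y <= f (l *: x + (1 - l) *: y).
Proof.
move=> cf x y l Ax Ay l0 l1.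
have := cf (Itv01 l0 l1) x y (mem_set Ax) (mem_set Ay).
by rewrite convRE /= !mulrN -opprD lerN2.
Qed.

Lemma concave_functionW (f : 'rV[R]_d -> R) :
  (forall x y (l : R), A x -> A y -> 0 <= l -> l <= 1 ->
  l * f x + (1 - l) * f y <= f (l *: x + (1 - l) *: y)) -> concave_function A f.
Proof.
move=> cf l x y xA yA; rewrite convRE !mulrN -opprD lerN2.
by apply: cf; [exact: set_mem|exact: set_mem|exact: ge0|exact: le1].
Qed.

Hypothesis cA : convex_set A.

(** Unnormalized weights keep the induction on the number of points free of
    rescaling; only the case where all previous weights vanish is special. *)
Lemma jensen_unnormalized (f : 'rV[R]_d -> R) : concave_function A f ->
  forall k (t : 'I_k -> R) (y : 'I_k -> 'rV[R]_d),
  (forall j, 0 <= t j) -> (forall j, A (y j)) -> 0 < \sum_j t j ->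
  let T := \sum_j t j in let x := T^-1 *: (\sum_j t j *: y j) in
  A x /\ \sum_j t j * f (y j) <= T * f x.
Proof.
move=> cf; elim=> [t y _ _|k IH t y t0 yA]; first by rewrite big_ord0 ltxx.
rewrite !big_ord_recr/=.
set T := \sum_(i < k) _; set x := \sum_(i < k) _; set F := \sum_(i < k) _ * _.
set s := t ord_max; set z := y ord_max => Ts.
have T0 : 0 <= T by apply: sumr_ge0 => j _; exact: t0.
have s0 : 0 <= s by exact: t0.
have [TE|TN] := eqVneq T 0.
  have t'0 j : t (widen_ord (leqnSn k) j) = 0.
    by apply: (psumr_eq0P _ TE) => // i _; exact: t0.
  have -> : x = 0 by rewrite /x big1// => j _; rewrite t'0 scale0r.
  have -> : F = 0 by rewrite /F big1// => j _; rewrite t'0 mul0r.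
  rewrite TE !add0r in Ts *.
  rewrite scalerA mulVf ?gt_eqF// scale1r; split => //.
  exact: yA.
have Tp : 0 < T by rewrite lt_neqAle eq_sym TN.
have [Ax Fx] := IH (t \o widen_ord (leqnSn k)) (y \o widen_ord (leqnSn k))
  (fun j => t0 _) (fun j => yA _) Tp.
set l := T / (T + s).
have l0 : 0 <= l by rewrite divr_ge0// ltW.
have l1 : l <= 1 by rewrite ler_pdivrMr// mul1r lerDl.
have lE : 1 - l = s / (T + s).
  by rewrite /l -{1}[1](@divff _ (T + s)) ?gt_eqF// -mulrBl addrAC subrr add0r.
have -> : (T + s)^-1 *: (x + s *: z) = l *: (T^-1 *: x) + (1 - l) *: z.
  by rewrite lE /l scalerDr !scalerA mulrAC divff ?mul1r 1?mulrC.
split; first by apply: (convex_setP cA) => //; exact: yA.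
apply: (@le_trans _ _
  ((T + s) * (l * f (T^-1 *: x) + (1 - l) * f z))); last first.
  by rewrite ler_pM2l//; apply: (concave_functionP cf) => //; exact: yA.
have -> : (T + s) * (l * f (T^-1 *: x) + (1 - l) * f z) =
    T * f (T^-1 *: x) + s * f z.
  have e a b : (T + s) * (a / (T + s) * b) = a * b.
    by rewrite mulrA [(T + s) * _]mulrC divfK ?gt_eqF.
  by rewrite mulrDr lE !e.
by rewrite lerD2r; exact: Fx.
Qed.

Lemma jensen_concave (f : 'rV[R]_d -> R) k (t : 'rV[R]_k)
    (y : 'I_k -> 'rV[R]_d) :
  concave_function A f -> simplex t -> (forall j, A (y j)) ->
  \sum_j t ord0 j * f (y j) <= f (\sum_j t ord0 j *: y j).
Proof.
move=> cf [t0 t1] yA.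
have := jensen_unnormalized cf (t := t ord0) t0 yA.
by rewrite /= t1 invr1 scale1r mul1r => /(_ ltr01)[].
Qed.

Lemma convex_combination k (t : 'rV[R]_k) (y : 'I_k -> 'rV[R]_d) :
  simplex t -> (forall j, A (y j)) -> A (\sum_j t ord0 j *: y j).
Proof.
move=> [t0 t1] yA.
have cf : concave_function A (fun=> 0).
  by apply: concave_functionW => x z l _ _ _ _; rewrite !mulr0 addr0.
have := jensen_unnormalized cf (t := t ord0) t0 yA.
by rewrite /= t1 invr1 scale1r mul1r => /(_ ltr01)[].
Qed.

End convex.

(** * Profiles and unilateral deviations *)

Section within.
Context {T U V : topologicalType}.

Lemma within_comp (K : set T) (P : set U) (h : T -> U) (g : U -> V) :
  continuous h -> (forall t, K t -> P (h t)) -> {within P, continuous g} ->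
  {within K, continuous (g \o h)}.
Proof.
move=> ch hKP /subspace_continuousP cg; apply/subspace_continuousP => t Kt A gA.
have /ch hA := cg _ (hKP _ Kt) _ gA.
by apply: (@filterS _ (nbhs t) _ _ _ _ hA) => z /= zA Kz; apply: zA; exact: hKP.
Qed.

End within.

Lemma continuous_prod (T : topologicalType) (I : Type)
    (K : I -> topologicalType) (h : T -> prod_topology K) :
  (forall i, continuous (fun t => h t i)) ->
  continuous h.
Proof.
move=> ch t; apply/cvg_sup => i A [B [[W] oW <-] Wt WA].
apply: (filterS WA); have := ch i t; apply.
by apply: open_nbhs_nbhs; split.
Qed.

Section deviate.
Variables (R : realType) (n : nat) (d : 'I_n -> nat).
Implicit Types (s : profile R d).

Lemma deviate_in s i x : deviate s x i = x :> 'rV[R]_(d i).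
Proof. by rewrite /deviate dfwithin. Qed.

Lemma deviate_out s i (x : 'rV[R]_(d i)) j : i != j -> deviate s x j = s j.
Proof. by move=> ij; rewrite /deviate dfwithout. Qed.

Lemma deviate_id s i : deviate s (s i) = s.
Proof.
apply: functional_extensionality_dep => j.
have [<-|ij] := eqVneq i j; first by rewrite deviate_in.
by rewrite deviate_out.
Qed.

Lemma continuous_deviate i (x : 'rV[R]_(d i)) :
  continuous (fun s => deviate s x).
Proof.
apply: continuous_prod => j; have [<-|ij] := eqVneq i j.
  rewrite (_ : (fun s => _) = fun=> x); first exact: cst_continuous.
  by apply/funext => s; rewrite deviate_in.
rewrite (_ : (fun s => _) = fun s => s j); first exact: proj_continuous.
by apply/funext => s; rewrite deviate_out.
Qed.

Lemma deviate_feasible (S : forall i, set 'rV[R]_(d i)) s i x :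
  (forall j, S j (s j)) -> S i x -> forall j, S j (deviate s x j).
Proof.
move=> Ss Sx j; have [<-|ij] := eqVneq i j; first by rewrite deviate_in.
by rewrite deviate_out.
Qed.

End deviate.

(** * Equilibria of concave games *)

Section nash.
Variables (R : realType) (n : nat) (d : 'I_n -> nat).
Variables (S : forall i, set 'rV[R]_(d i)) (W : 'I_n -> profile R d -> R).
Arguments S : clear implicits.
Hypotheses (S_nonempty : forall i, S i !=set0)
  (S_convex : forall i, convex_set (S i))
  (S_compact : forall i, compact (S i)).

Definition feasible : set (profile R d) := [set s | forall j, S j (s j)].

Hypotheses (W_cont : forall i, {within feasible, continuous (W i)})
  (W_concave : forall i s, feasible s ->
     concave_function (S i) (fun x => W i (deviate s x))).

(** The Nikaido-Isoda function: [s] is an equilibrium as soon as no [y] has a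
    positive gain. *)
Definition gain (s y : profile R d) : R :=
  \sum_i (W i (deviate s (y i)) - W i s).

Lemma gain_continuous y : feasible y ->
  {within feasible, continuous (gain ^~ y)}.
Proof.
move=> Py; apply: (@continuous_big _ _ +%R 0) => [|i _].
  exact: add_continuous.
apply: within_continuousB => //.
apply: (within_comp (K := feasible) (P := feasible)
  (h := fun s => deviate s (y i))) => //.
  exact: continuous_deviate.
by move=> s Ps; exact: deviate_feasible.
Qed.

(** Cover the simplex of mixtures [so t] of the [y j] by the sets of those [t]
    against which [y l] has maximal gain.  By [simplex_cover] there is a [t]
    such that every [y l] of positive weight in [so t] has maximal gain.  So the
    maximal gain is the average, with weights [t], of the gains of the [y l],
    which by concavity is at most the gain of the mixture [so t] over itself,
    that is 0. *)
Lemma gain_finite p (y : 'I_p.+1 -> profile R d) : (forall j, feasible (y j)) ->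
  exists2 s, feasible s & forall j, gain s (y j) <= 0.
Proof.
move=> Py; pose so (t : 'rV[R]_p.+1) : profile R d :=
  fun i => \sum_j t ord0 j *: y j i.
have so_cont : continuous so.
  apply: continuous_prod => i; rewrite /so.
  apply: (@continuous_big 'rV[R]_(d i) _ +%R 0) => [|j _].
    exact: add_continuous.
  move=> t; apply: (@cvgZ _ _ _ (nbhs t) _ (fun u : 'rV[R]_p.+1 => u ord0 j)).
    exact: coord_continuous.
  exact: cvg_cst.
have Pso t : simplex t -> feasible (so t).
  by move=> st i; apply: convex_combination => // j; exact: Py.
pose A l :=
  [set t | simplex t /\ forall j, gain (so t) (y j) <= gain (so t) (y l)].
have gc j :
    {within @simplex R p.+1, continuous (fun t => gain (so t) (y j))}.
  exact: (within_comp so_cont Pso (gain_continuous (Py j))).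
have cA l : closed (A l).
  have cs : closed (@simplex R p.+1).
    by apply: compact_closed; [exact: norm_hausdorff|exact: compact_simplex].
  rewrite (_ : A l = \bigcap_j (@simplex R p.+1 `&`
     (fun t => gain (so t) (y j) - gain (so t) (y l)) @^-1`
       [set x : R | x <= 0])).
    apply: closed_bigI => j _; rewrite (closed_setSI _ cs).
    apply: (@closed_comp (subspace (@simplex R p.+1)) R); last exact: closed_le.
    by move=> t _; apply: within_continuousB.
  apply/seteqP; split => t /=.
    by move=> [st tA] j _; split; rewrite //= subr_le0.
  move=> h; split; first by have [] := h ord0 I.
  by move=> j; have [_ /=] := h j I; rewrite subr_le0.
have cov t : simplex t -> exists l, A l t.
  move=> st.
  pose l := [arg max_(j > ord0 | true) gain (so t) (y j)]%O.
  exists l; split => // j; rewrite /l; case: arg_maxP => // i _; exact.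
have [t st tA] := simplex_cover cA cov.
exists (so t); first exact: Pso.
have [l tl] : exists l, 0 < t ord0 l.
  apply/not_existsP => h; have [t0 /eqP] := st.
  rewrite big1 ?(eq_sym 0) ?oner_eq0// => i _.
  by apply/eqP; rewrite eq_le t0 andbT leNgt; apply/negP/h.
have [_ lmax] := tA _ tl.
suff gl : gain (so t) (y l) <= 0 by move=> j; exact: le_trans (lmax j) gl.
have [t0 t1] := st.
rewrite -[leLHS]mul1r -t1 mulr_suml.
rewrite (eq_bigr (fun j => t ord0 j * gain (so t) (y j))); last first.
  move=> j _; have := t0 j; rewrite le_eqVlt => /predU1P[<-|tj].
    by rewrite !mul0r.
  congr (_ * _); apply/eqP; rewrite eq_le lmax andbT.
  by have [_] := tA _ tj; exact.
under eq_bigr do rewrite mulr_sumr.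
rewrite exchange_big/=; apply: sumr_le0 => i _.
under eq_bigr do rewrite mulrBr.
rewrite sumrB -mulr_suml t1 mul1r subr_le0.
have yS j : S i (y j i) by exact: Py.
have := jensen_concave (@S_convex i) (W_concave (i := i) (Pso t st)) st yS.
by rewrite (deviate_id (so t) i : deviate _ (\sum_j _) = _).
Qed.

(** The sets of profiles against which [y] has no positive gain, where [y]
    ranges over the feasible profiles, have the finite intersection property by
    [gain_finite].  A cluster point of the filter that they generate has no
    profitable deviation, by continuity. *)
Theorem concave_game_nash : exists2 s, feasible s &
  forall i x, S i x -> W i (deviate s x) <= W i s.
Proof.
have cP : compact feasible by exact: tychonoff.
have [s0 Ps0] : exists s0, feasible s0.
  exists (fun i => xget 0 (S i)) => i.
  by case: (S_nonempty i) => x; exact: xgetI.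
pose f y := [set s | feasible s /\ gain s y <= 0].
have fI : finI feasible f.
  move=> D' D'P; pose e := enum_fset D'.
  pose y (j : 'I_(size e).+1) := nth s0 (s0 :: e) j.
  have Py j : feasible (y j).
    have : y j \in s0 :: e by rewrite mem_nth.
    by rewrite in_cons => /predU1P[->//|/D'P/set_mem].
  have [s Ps sy] := gain_finite Py.
  exists s => u /= uD'; split => //.
  have ui : ((index u e).+1 < (size e).+1)%N by rewrite ltnS index_mem.
  by have := sy (Ordinal ui); rewrite /y /= nth_index.
have FF := finI_filter fI.
have [|s [Ps clu]] := cP _ FF.
  by exists (f s0); [exact: finI_from1|by move=> s []].
exists s => // i x Six; pose y := deviate s x.
have Py : feasible y by exact: deviate_feasible.
have : gain s y <= 0.
  rewrite leNgt; apply/negP => gp.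
  have /subspace_continuousP/(_ _ Ps) gc := gain_continuous Py.
  have [] := clu (f y) _ _ (cvgr_gt _ gc _ gp).
    by exists (f y) => //; exact: finI_from1.
  by move=> u [[Pu gu]] /(_ Pu); rewrite ltNge gu.
rewrite /gain (bigD1 i)//= big1 ?addr0; last first.
  by move=> j ji; rewrite /y deviate_out 1?eq_sym// deviate_id subrr.
by rewrite /y deviate_in subr_le0.
Qed.

End nash.

(** * Expectations of continuous functions on a compact set *)

Section borel.
Variables (R : realType) (m : nat).

Lemma measurable_open_rV (A : set 'rV[R]_m) :
  open A -> measurable (A : set (borel R m)).
Proof. by move=> oA; exact: sub_sigma_algebra. Qed.

Lemma measurable_compact_rV (A : set 'rV[R]_m) :
  compact A -> measurable (A : set (borel R m)).
Proof.
move=> /(compact_closed (@norm_hausdorff _ _)) cA; rewrite -[A]setCK.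
by apply: measurableC; apply: measurable_open_rV; exact: closed_openC.
Qed.

Lemma measurable_within_continuous (A : set 'rV[R]_m) (f : 'rV[R]_m -> R) :
  measurable (A : set (borel R m)) -> {within A, continuous f} ->
  measurable_fun (A : set (borel R m)) (f : borel R m -> R).
Proof.
move=> mA /continuousP cf.
apply: (measurability _ (measurable_realfun.RGenOpens.measurableE R)).
move=> _ [_ [a [b ->] <-]].
have /open_subspaceP[V oV VA] :=
  cf _ (@interval_open R (BRight a) (BLeft b) isT isT).
rewrite setIC -VA; apply: measurableI => //; exact: measurable_open_rV.
Qed.
End borel.

Section expectation.
Variables (R : realType) (m : nat) (Xi : set 'rV[R]_m).
Hypothesis Xi_compact : compact Xi.
Implicit Types (Q : probability (borel R m) R) (f g : 'rV[R]_m -> R).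

Definition mean Q f : R := (\int[Q]_(x in Xi) f x)%R.

Let mXi : measurable (Xi : set (borel R m)) := measurable_compact_rV Xi_compact.

Lemma compact_continuous_bounded f : {within Xi, continuous f} ->
  exists M, forall x, Xi x -> `|f x| <= M.
Proof.
move=> cf; have /compact_bounded[M [_ MA]] := continuous_compact cf Xi_compact.
exists (M + 1) => x Xx; apply: MA; first by rewrite ltrDl.
by exists x.
Qed.

Lemma integrable_continuous Q f : {within Xi, continuous f} ->
  Q.-integrable Xi (EFin \o f).
Proof.
move=> cf; apply: measurable_bounded_integrable => //.
- by apply: (le_lt_trans (probability_le1 Q mXi)); rewrite ltry.
- exact: measurable_within_continuous.
have [M Mf] := compact_continuous_bounded cf.
exists M; split => [|M' MM' x Xx]; first by rewrite num_real.
by apply: le_trans (Mf _ Xx) _; exact: ltW.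
Qed.

Lemma expectation_onE Q f : {within Xi, continuous f} ->
  expectation_on Xi Q f = (mean Q f)%:E.
Proof.
move=> cf; rewrite /mean /Rintegral fineK//; apply: integrable_fin_num => //.
exact: integrable_continuous.
Qed.

Lemma mean_le Q f g (e : R) : Q Xi = 1%E -> {within Xi, continuous f} ->
  {within Xi, continuous g} ->
  (forall x, Xi x -> f x <= g x + e) -> mean Q f <= mean Q g + e.
Proof.
move=> QXi cf cg fg.
have ce : {within Xi, continuous (fun=> e)} by move=> x; exact: cvg_cst.
have -> : e = mean Q (fun=> e) 
  by rewrite /mean Rintegral_cst// (congr1 fine QXi) mulr1.
rewrite -RintegralD//; try exact: integrable_continuous.
apply: le_Rintegral => //; try exact: integrable_continuous.
apply: integrable_continuous; exact: within_continuousD.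
Qed.

Lemma mean_linear Q f g (a b : R) : {within Xi, continuous f} ->
  {within Xi, continuous g} ->
  mean Q (fun x => a * f x + b * g x) = a * mean Q f + b * mean Q g.
Proof.
move=> cf cg; rewrite /mean RintegralD//; last 2 first.
- by apply: integrable_continuous => x; apply: cvgMr; exact: cf.
- by apply: integrable_continuous => x; apply: cvgMr; exact: cg.
by rewrite !RintegralZl//; exact: integrable_continuous.
Qed.

End expectation.

(** * Worst-case expectations *)

Section ambiguity_game.
Variables (R : realType) (n m : nat) (d : 'I_n -> nat).
Variables (S : forall i, set 'rV[R]_(d i)) (Xi : set 'rV[R]_m).
Arguments S : clear implicits.
Variables (U : 'I_n -> profile R d -> 'rV[R]_m -> R).
Variables (amb : 'I_n -> set (probability (borel R m) R)).
Hypotheses (Xi_compact : compact Xi)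
  (amb_Xi : forall i Q, amb i Q -> Q Xi = 1%E)
  (S_nonempty : forall i, S i !=set0)
  (S_convex : forall i, convex_set (S i))
  (S_compact : forall i, compact (S i))
  (U_continuous : forall i,
    {within [set z : profile R d * 'rV[R]_m |
               (forall j, S j (z.1 j)) /\ Xi z.2],
      continuous (fun z => U i z.1 z.2)})
  (U_concave : forall i s xi, (forall j, S j (s j)) -> Xi xi ->
    concave_function (S i) (fun x => U i (deviate s x) xi)).

Lemma utility_continuous_scenario i s : feasible S s ->
  {within Xi, continuous (U i s)}.
Proof.
move=> Ps; have cs : continuous (fun xi : 'rV[R]_m => (s, xi)).
  move=> xi.
  apply: (@cvg_pair _ _ _ (nbhs xi) (nbhs s) (nbhs xi) _ _ _ (fun=> s) id).
    exact: cvg_cst.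
  exact: cvg_id.
by apply: (within_comp cs _ (@U_continuous i)) => xi Xxi; split.
Qed.

(** Compactness of [Xi] turns joint continuity into continuity in the strategies
    that is uniform in the uncertain parameter. *)
Lemma utility_near_uniform i s (e : R) : feasible S s -> 0 < e ->
  \forall s' \near within (feasible S) (nbhs s),
    Xi `<=` [set xi | `|U i s xi - U i s' xi| < e].
Proof.
move=> Ps e0; have /compact_near_coveringP/near_covering_withinP := Xi_compact.
apply => xi Xxi.
have /subspace_continuousP/(_ (s, xi)) cU := @U_continuous i.
have e2 : 0 < e / 2 by rewrite divr_gt0.
have /cvgrPdist_lt/(_ _ e2)[[A B] /= [sA xB] AB] := cU (conj Ps Xxi).
exists (B, [set s' | A s' /\ feasible S s']) => /=.
  split => //; apply: filterS sA => s' As' Ps'; by split.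
move=> [xi' s'] /= [Bxi [As' Ps']] Xxi'.
have h1 := AB (s', xi') (conj As' Bxi) (conj Ps' Xxi').
have h2 := AB (s, xi') (conj (nbhs_singleton sA) Bxi) (conj Ps Xxi').
rewrite /= -(subrKA (U i s xi)) (splitr e).
apply: le_lt_trans (ler_normD _ _) _; apply: ltrD => //.
by rewrite distrC.
Qed.

(** If [amb i] is empty, this is a constant without meaning for the game, whose
    utility is then [+oo] at every profile. *)
Definition worst_mean i s : R := inf [set mean Xi Q (U i s) | Q in amb i].

Lemma worst_mean_has_lbound i s : feasible S s ->
  has_lbound [set mean Xi Q (U i s) | Q in amb i].
Proof.
move=> Ps; have cU := utility_continuous_scenario (i := i) Ps.
have [M MU] := compact_continuous_bounded Xi_compact cU.
exists (- M) => _ [Q Qi <-]; have QXi := amb_Xi Qi.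
have cM : {within Xi, continuous (fun=> - M)} by move=> x; exact: cvg_cst.
have mXi := measurable_compact_rV Xi_compact.
have -> : - M = mean Xi Q (fun=> - M).
  by rewrite /mean Rintegral_cst// (congr1 fine QXi) mulr1.
rewrite -[leRHS]addr0; apply: mean_le => // x Xx.
by rewrite addr0; have := MU x Xx; rewrite ler_norml => /andP[].
Qed.

Lemma le_worst_mean i s a : amb i !=set0 ->
  (forall Q, amb i Q -> a <= mean Xi Q (U i s)) -> a <= worst_mean i s.
Proof.
move=> [Q0 Q0i] aU; apply: lb_le_inf; first by exists (mean Xi Q0 (U i s)), Q0.
by move=> _ [Q Qi <-]; exact: aU.
Qed.

Lemma worst_mean_le i s Q : feasible S s -> amb i Q ->
  worst_mean i s <= mean Xi Q (U i s).
Proof.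
move=> Ps Qi; apply: ge_inf; first exact: worst_mean_has_lbound.
by exists Q.
Qed.

Lemma worst_mean_perturb i s s' e : amb i !=set0 ->
  feasible S s -> feasible S s' ->
  (forall xi, Xi xi -> U i s xi <= U i s' xi + e) ->
  worst_mean i s <= worst_mean i s' + e.
Proof.
move=> Q0 Ps Ps' h; rewrite -lerBlDr; apply: le_worst_mean => // Q Qi.
rewrite lerBlDr; apply: le_trans (worst_mean_le Ps Qi) _.
by apply: mean_le => //; [exact: amb_Xi Qi| |];
  exact: utility_continuous_scenario.
Qed.

Lemma worst_mean_empty i s : amb i = set0 -> worst_mean i s = inf set0.
Proof. by move=> Q0; rewrite /worst_mean Q0 image_set0. Qed.

(** A perturbation of the integrand that is uniformly at most [e] moves every
    expectation, hence the infimum, by at most [e]. *)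
Lemma worst_mean_continuous i : {within feasible S, continuous (worst_mean i)}.
Proof.
have [Q0|/set0P Q0] := eqVneq (amb i) set0.
  rewrite (_ : worst_mean i = fun=> inf set0).
    by move=> x; exact: cvg_cst.
  by apply/funext => s; exact: worst_mean_empty.
apply/subspace_continuousP => s Ps; apply/cvgrPdist_le => e e0.
have Pw : \forall s' \near within (feasible S) (nbhs s), feasible S s'.
  exact: withinT.
near=> s'; have Ps' : feasible S s' by near: s'.
have Us : Xi `<=` [set xi | `|U i s xi - U i s' xi| < e].
  by near: s'; exact: utility_near_uniform.
rewrite ler_distl; apply/andP; split.
  rewrite lerBlDr; apply: worst_mean_perturb => // xi /Us /=.
  by rewrite ltr_norml => /andP[? ?]; lra.
apply: worst_mean_perturb => // xi /Us /=.
by rewrite ltr_norml => /andP[? ?]; lra.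
Unshelve. all: by end_near. Qed.

(** Expectations preserve concavity, and so do infima. *)
Lemma worst_mean_concave i s : feasible S s ->
  concave_function (S i) (fun x => worst_mean i (deviate s x)).
Proof.
move=> Ps; apply: concave_functionW => x y l Sx Sy l0 l1.
have [Q0|/set0P Q0] := eqVneq (amb i) set0.
  by rewrite !worst_mean_empty// -mulrDl addrC subrK mul1r.
have Px := deviate_feasible Ps Sx; have Py := deviate_feasible Ps Sy.
have Sxy := convex_setP (@S_convex i) Sx Sy l0 l1.
have Pxy := deviate_feasible Ps Sxy.
have l1' : 0 <= 1 - l by rewrite subr_ge0.
apply: le_worst_mean => // Q Qi.
apply: (@le_trans _ _ (l * mean Xi Q (U i (deviate s x)) +
  (1 - l) * mean Xi Q (U i (deviate s y)))).
  by apply: lerD; apply: ler_wpM2l => //; exact: worst_mean_le.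
have cx := utility_continuous_scenario (i := i) Px.
have cy := utility_continuous_scenario (i := i) Py.
rewrite -mean_linear// -[leRHS]addr0; apply: mean_le => //.
- exact: amb_Xi Qi.
- move=> z; apply: cvgD; apply: cvgMr; [exact: cx|exact: cy].
- exact: utility_continuous_scenario.
- move=> xi Xxi; rewrite addr0.
  exact: (concave_functionP (U_concave Ps Xxi)).
Qed.

Lemma utility_worst_mean i s : amb i !=set0 -> feasible S s ->
  ereal_inf [set expectation_on Xi Q (U i s) | Q in amb i] =
  (worst_mean i s)%:E.
Proof.
move=> [Q0 Q0i] Ps; rewrite -ereal_inf_EFin; last 2 first.
- exact: worst_mean_has_lbound.
- by exists (mean Xi Q0 (U i s)), Q0.
congr ereal_inf; rewrite image_comp; apply: eq_imagel => Q _ /=.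
by rewrite expectation_onE//; exact: utility_continuous_scenario.
Qed.

(** Covers both games of interest: the ambiguity sets may be Wasserstein balls
    or singletons. *)
Theorem ambiguity_game_nash : nash_equilibria (Game S (fun i s =>
  ereal_inf [set expectation_on Xi Q (U i s) | Q in amb i])) !=set0.
Proof.
have [s Ps sN] := concave_game_nash S_nonempty S_convex S_compact
  worst_mean_continuous worst_mean_concave.
exists s; split => // i x /= Six.
have [->|/set0P Q0] := eqVneq (amb i) set0; first by rewrite !image_set0.
rewrite !utility_worst_mean//; last exact: deviate_feasible.
by rewrite lee_fin sN.
Qed.
End ambiguity_game.

Theorem proposition15 (R : realType) (n m N : nat) (d : 'I_n -> nat)
  (S : forall i : 'I_n, set 'rV[R]_(d i))
  (Xi : set 'rV[R]_m)
  (U : 'I_n -> profile R d -> 'rV[R]_m -> R)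
  (Pstar : probability (borel R m) R)
  (dO : measure_display) (Omega : measurableType dO) (Pr : probability Omega R)
  (X : 'I_N -> {RV Pr >-> borel R m})
  (h : 'rV[R]_m -> 'rV[R]_m)
  (eps D L : 'I_n -> R)
  (N_gt0 : (0 < N)%N)
  (Xi_compact : compact Xi)
  (Pstar_Xi : distributions_on Xi Pstar)
  (Pstar_ac : Pstar `<< @lebesgue_rV R m)
  (Pstar_light : light_tailed Pstar)
  (X_iid : iid Pstar X)
  (eps_ge0 : forall i, 0 <= eps i)
  (S_nonempty : forall i, S i !=set0)
  (S_convex : forall i, convex_set (S i))
  (S_compact : forall i, compact (S i))
  (D_ge0 : forall i, 0 <= D i)
  (S_diameter : forall i, diameter (S i) = (D i)%:E)
  (U_continuous : forall i,
    {within [set z : profile R d * 'rV[R]_m |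
               (forall j, S j (z.1 j)) /\ Xi z.2],
      continuous (fun z => U i z.1 z.2)})
  (U_concave : forall i s xi, (forall j, S j (s j)) -> Xi xi ->
    concave_function (S i) (fun x => U i (deviate s x) xi))
  (U_lipschitz : forall i s, (forall j, S j (s j)) ->
    forall xi xi', Xi xi -> Xi xi' ->
      `|U i s xi - U i s xi'| <= L i * norm2 (xi - xi')) :
  (forall w : Omega,
     nash_equilibria
       (robust_game S Xi U eps (empirical (fun k => h (X k w)))) !=set0) /\
  nash_equilibria (stochastic_game S Xi U Pstar) !=set0.
Proof.
split=> [w|].
  by apply: (ambiguity_game_nash (S := S) Xi_compact) => // i Q [[]].
suff -> : stochastic_game S Xi U Pstar = Game S (fun i s =>
    ereal_inf [set expectation_on Xi Q (U i s) | Q in [set Pstar]]).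
  apply: (ambiguity_game_nash (S := S) (amb := fun=> [set Pstar])) => //.
  by move=> _ Q ->; case: Pstar_Xi.
congr Game; apply/funext => i; apply/funext => s.
by rewrite image_set1 ereal_inf1.
Qed.
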